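(* Let $\kappa$ be a cardinal and suppose there is a cofinal Kurepa family in $[\kappa]^\omega$. If $\kappa \in \mathfrak{sp}(\text{Borel})$, then $\mathrm{cf}[\kappa]^\omega \in \mathfrak{sp}(\text{Borel})$.
   Context: $\mathfrak{sp}(\text{Borel}) = \{|\mathcal{P}| : \mathcal{P} \text{ is a partition of } \mathbb{R} \text{ into uncountably many Borel sets}\}$. $[A]^\omega$ denotes the set of countably infinite subsets of $A$. A family $\mathcal{F} \subseteq [A]^\omega$ is cofinal in $[A]^\omega$ if for every $X \in [A]^\omega$ there is $Y \in \mathcal{F}$ with $Y \supseteq X$; it is Kurepa if $\{X \cap Y : Y \in \mathcal{F}\}$ is countable for every countable set $X$; a cofinal Kurepa family is one that is both. $\mathrm{cf}[A]^\omega = \min\{|\mathcal{F}| : \mathcal{F} \text{ cofinal in } [A]^\omega\}$. *)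

(* Defs.v *)
From mathcomp Require Export all_boot all_order all_algebra.
From mathcomp Require Export all_classical all_reals all_analysis.
Export numFieldNormedType.Exports.

Set Implicit Arguments.
Unset Strict Implicit.
Unset Printing Implicit Defensive.


Local Open Scope classical_set_scope.
Local Open Scope card_scope.

(* Cardinals are represented by arbitrary sets, compared with [#=] and [#<=];
   all the notions below are invariant under [#=] of the sets that stand for
   cardinals. *)

Definition ctbl_inf_subsets (T : Type) (A : set T) : set (set T) :=
  [set X | X `<=` A /\ X #= [set: nat]].

Definition cofinal_family (T : Type) (A : set T) (F : set (set T)) : Prop :=
  F `<=` ctbl_inf_subsets A /\
  forall X, ctbl_inf_subsets A X -> exists2 Y, F Y & X `<=` Y.

Definition kurepa_family (T : Type) (A : set T) (F : set (set T)) : Prop :=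
  F `<=` ctbl_inf_subsets A /\
  forall X : set T, countable X -> countable [set X `&` Y | Y in F].

Definition cofinal_kurepa_family (T : Type) (A : set T) (F : set (set T)) :
    Prop :=
  cofinal_family A F /\ kurepa_family A F.

(* [is_cf A C] : the cardinality of C is cf[A]^omega, i.e. it is the least
   element of { |F| : F cofinal in [A]^omega }. *)
Definition is_cf (T U : Type) (A : set T) (C : set U) : Prop :=
  (exists2 F, cofinal_family A F & C #= F) /\
  forall G, cofinal_family A G -> C #<= G.

Definition borel_set (R : realType) (B : set R) : Prop := <<s @open R >> B.

(* [in_sp_borel R C] : the cardinality of C belongs to sp(Borel). *)
Definition in_sp_borel (R : realType) (U : Type) (C : set U) : Prop :=
  exists P : set (set R),
    [/\ partition P id [set: R],
        forall B, P B -> borel_set B,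
        ~ countable P
      & C #= P].

(* Main.v *)
(**
Code a point x of R as a sequence (p_n x)_n of reals by a Borel map onto R^N,
and let i : R -> kappa send a real to its piece of the given partition, so that
x yields the countable set S x = {i (p_n x) : n} of elements of kappa.  Fix a
cofinal subfamily F0 of the Kurepa family of least cardinality cf[kappa]^omega,
well-order it, and send x to the least m x in F0 that includes S x.  The fibre
of m at Y is {x | S x <= Y} minus the union of the sets {x | S x <= Y `&` Z}
over the Z preceding Y; the Kurepa property leaves only countably many distinct
Y `&` Z, so the fibre is Borel.  As every countable subset of kappa lies in
some S x, the range of m is cofinal, hence has cardinality cf[kappa]^omega.
*)
Require Import Defs.
From mathcomp Require Import wochoice measurable_realfun lra.

Set Implicit Arguments.
Unset Strict Implicit.
Unset Printing Implicit Defensive.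

Import Order.TTheory GRing.Theory Num.Theory.

Local Open Scope classical_set_scope.

(* A maximal family of choice functions with pairwise distinct values in every
   member of P must exhaust some member G; G then injects in all the others. *)
Lemma exists_least_card (U : Type) (P : set (set U)) : P !=set0 ->
  exists2 G, P G & forall H, P H -> (G #<= H)%card.
Proof.
move=> [G0 PG0].
pose Q : set (set (set U -> U)) := [set S : set (set U -> U) |
  (forall f G, S f -> P G -> G (f G)) /\
  forall G, P G -> {in S &, injective (fun f => f G)}].
have [S [[SG Sinj] Smax]] : exists S, Q S /\ forall S', S `<` S' -> ~ Q S'.
  apply: Zorn_bigcup => F FQ Ftot; split => [f G [S FS Sf]|G PG f g].
    exact: ((FQ _ FS).1 f G).
  rewrite !inE => -[S FS Sf] [S' FS' S'g].
  have [SS'|SS'] := Ftot _ _ FS FS'.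
  - by apply: (FQ _ FS').2 => //; rewrite inE//; exact: SS'.
  - by apply: (FQ _ FS).2 => //; rewrite inE//; exact: SS'.
have [G PG GS] : exists2 G, P G & forall u, G u -> exists2 f, S f & f G = u.
  (* Otherwise every member of [P] has an element that is no value of [S] there; choosing such
     elements gives a function that enlarges [S]. *)
  apply: contrapT => noG.
  have new G : P G -> exists u, G u /\ forall f, S f -> f G <> u.
    move=> PG; apply: contrapT => nou; apply: noG; exists G => // u Gu.
    apply: contrapT => nof; apply: nou; exists u; split => // f Sf fGu.
    by apply: nof; exists f.
  have [u0 _] := new _ PG0.
  have /choice[f fP] : forall G, exists u, P G ->
      G u /\ forall f, S f -> f G <> u.
    move=> G; have [PG|nPG] := pselect (P G); last by exists u0.
    by have [u uP] := new _ PG; exists u.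
  have nSf : ~ S f by move=> /(fP _ PG0).2; apply.
  apply: (Smax (f |` S)).
    split; first by move=> g Sg; right.
    by move=> /(_ f (or_introl erefl)).
  split=> [g G [->|Sg] PG|G PG g h]; [exact: (fP _ PG).1|exact: (SG g G)|].
  rewrite !inE => -[->|Sg] [->|Sh] // gh.
  - by case: ((fP _ PG).2 _ Sh).
  - by case: ((fP _ PG).2 _ Sg).
  - by apply: (Sinj _ PG) => //; rewrite inE.
exists G => // H PH.
(* Evaluation at [G] covers [G] by [S], and evaluation at [H] injects [S] into [H]. *)
have GE : G `<=` (fun f => f G) @` S by move=> u /GS[f Sf fu]; exists f.
apply: (card_le_trans (subset_card_le GE)).
apply: (card_le_trans (card_image_le _ _)).
rewrite -(card_le_eql (inj_card_eq (Sinj _ PH))).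
by apply: subset_card_le => _ [f Sf <-]; exact: (SG f H).
Qed.

(** * Borel sets and measurability *)

Lemma borel_setE (R : realType) (B : set R) : borel_set B <-> measurable B.
Proof.
split; first by apply: smallest_sub; [exact: sigma_algebra_measurable|
                                       move=> A; exact: open_measurable].
move=> mB; suff: <<s RGenOpens.G (R:=R) >> B.
  apply: smallest_sub; first exact: smallest_sigma_algebra.
  by move=> _ [x [y ->]]; apply: sub_sigma_algebra; exact: interval_open.
(* [measurable] is generated by half-open intervals; open intervals generate the same
   sigma-algebra. *)
have := mB; rewrite -[X in X -> _]/((@ocitv R).-sigma.-measurable B).
by rewrite RGenOpens.measurableE.
Qed.

Lemma measurable_countable_bigcup (d : measure_display) (T : measurableType d)
    (I : Type) (D : set I) (F : I -> set T) : countable D ->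
  (forall i, D i -> measurable (F i)) -> measurable (\bigcup_(i in D) F i).
Proof.
move=> cD mF; rewrite bigcup_set_type.
apply: countable_bigcupT_measurable => [|i]; last exact/mF/set_valP.
by rewrite (eq_countable (card_setT D)).
Qed.

(** * Coding sequences of reals by a real *)

Local Open Scope ring_scope.

(* When all base-4 digits of x are 0 or 1, [digit1 R k x] holds iff the digit of
   weight 4^-(k+1) is 1. *)
Definition digit1 (R : realType) (k : nat) : set R :=
  [set x | exists m : nat, `|4 ^+ k.+1 * x - (4 * m%:R + 1)| < 2^-1].
Arguments digit1 : clear implicits.

Lemma measurable_digit1 (R : realType) k : measurable (digit1 R k).
Proof.
have -> : digit1 R k = \bigcup_m
    [set x : R | `|4 ^+ k.+1 * x - (4 * m%:R + 1)| < 2^-1].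
  by apply/seteqP; split => [x [m]|x [m _]]; exists m.
apply: bigcupT_measurable => m.
pose f (x : R) := `|4 ^+ k.+1 * x - (4 * m%:R + 1)|.
have mf : measurable_fun setT f.
  by apply: measurableT_comp => //; exact: measurable_funB.
have -> : [set x | f x < 2^-1] = setT `&` f @^-1` `]-oo, 2^-1[.
  by apply/seteqP; split => x; rewrite /= in_itv/= => -[].
exact: mf.
Qed.

(** Take x = sum of a_k 4^-(k+1). The tail after digit k, scaled by 4^(k+1), lies in [0, 1/3], so
    the scaled x is within 1/2 of some 4m + 1 exactly when a_k = 1. *)
Lemma exists_digit1 (R : realType) (a : nat -> bool) :
  exists x, forall k, digit1 R k x <-> a k.
Proof.
(* [N n] has base-4 digits a_0 ... a_(n-1). The truncations [s] increase and the bounds [t]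
   decrease, 1/3 being the largest scaled tail, the sum of 4^-j over j >= 1. *)
pose N := fix N n : nat := if n is n'.+1 then (4 * N n' + a n')%N else 0%N.
pose s n : R := (N n)%:R / 4 ^+ n.
pose t n : R := ((N n)%:R + 3^-1) / 4 ^+ n.
have p4 n : 0 < 4 ^+ n :> R by apply: exprn_gt0.
have NS n : (N n.+1)%:R = 4 * (N n)%:R + (a n)%:R :> R by rewrite natrD natrM.
have a01 n : 0 <= ((a n)%:R : R) <= 1 by case: (a n); rewrite ?lexx ler01.
have sS n : s n <= s n.+1.
  rewrite /s ler_pdivrMr// NS exprS invfM mulrA divfK ?gt_eqF//.
  by have := a01 n; lra.
have tS n : t n.+1 <= t n.
  rewrite /t ler_pdivlMr// NS exprS invfM mulrA divfK ?gt_eqF//.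
  by have := a01 n; lra.
have st m n : s m <= t n.
  have sh : {homo s : i j / (i <= j)%N >-> i <= j} by exact/nondecreasing_seqP.
  have th : {homo t : i j / (i <= j)%N >-> j <= i} by exact/nonincreasing_seqP.
  apply: (le_trans (sh _ _ (leq_maxl m n))).
  apply: (le_trans _ (th _ _ (leq_maxr m n))).
  by rewrite ler_pM2r ?invr_gt0// lerDl.
have us : has_sup (range s).
  by split; [exists (s 0%N), 0%N|exists (t 0%N) => _ [m _ <-]].
exists (sup (range s)) => k; set x := sup _.
have sx : s k.+1 <= x by apply: ub_le_sup; [exact: us.2|exists k.+1].
have xt : x <= t k.+1 by apply: ge_sup; [exact: us.1|move=> _ [m _ <-]].
move: sx xt; rewrite ler_pdivrMr// ler_pdivlMr// [x * _]mulrC NS.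
rewrite /digit1/=; set y := _ * x; case: (a k) => /= sx xt; split => //.
- by move=> _; exists (N k); rewrite ltr_norml; apply/andP; split; lra.
- move=> [m]; rewrite ltr_norml => /andP[].
  have [mN|] := ltnP m (N k).
    have : (m.+1)%:R <= (N k)%:R :> R by rewrite ler_nat.
    by rewrite -natr1; lra.
  by rewrite -(ler_nat R); lra.
Qed.

(** The digits of x, indexed by pairs (n, q), select for each n a set of rationals, and p_n x is its
    supremum. Prescribing the digits so that q is selected iff q < y_n gives p_n x = y_n. *)
Lemma exists_measurable_surj_seq (R : realType) : exists p : nat -> R -> R,
  (forall n, measurable_fun setT (p n)) /\
  forall y : nat -> R, exists x, forall n, p n x = y n.
Proof.
pose D (n : nat) (q : rat) := digit1 R (choice.pickle (n, q)).
pose h n x : \bar R := ereal_sup [set (ratr q)%:E | q in [set q | D n q x]].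
(* [fine] turns an infinite supremum (no rationals, or unboundedly large ones) into 0. *)
exists (fun n x => fine (h n x)); split => [n|y].
  apply: measurableT_comp => //.
  apply: (measurability _ (ErealGenOInfty.measurableE R)) => //.
  move=> _ [_ [r ->] <-]; rewrite setTI.
  have -> : h n @^-1` `]r%:E, +oo[ =
      \bigcup_(q in [set q : rat | r < ratr q]) D n q.
    apply/seteqP; split => [x|x [q /= rq Dx]].
      rewrite /= in_itv/= andbT => /ereal_sup_gt[_ [q Dx <-]].
      by rewrite lte_fin => rq; exists q.
    rewrite /= in_itv/= andbT; apply/ereal_sup_gtP.
    by exists (ratr q)%:E; [exists q|rewrite lte_fin].
  by apply: measurable_countable_bigcup => // q _; exact: measurable_digit1.
pose a k := if choice.unpickle k is Some (n, q) then ratr q < y n else false.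
have [x xP] := exists_digit1 R a; exists x => n.
have DE q : D n q x <-> ratr q < y n by rewrite /D xP /a choice.pickleK.
suff -> : h n x = (y n)%:E by [].
apply/eqP; rewrite eq_le; apply/andP; split.
  by apply: ge_ereal_sup => _ [q /DE qy <-]; rewrite lee_fin ltW.
rewrite leNgt; apply/negP => hy.
have hq q : ratr q < y n -> ((ratr q)%:E <= h n x)%E.
  by move=> qy; apply: ereal_sup_ubound; exists q => //; exact/DE.
case: (h n x) hy hq => [r||] // hy hq.
  have [q] := rat_in_itvoo (hy : r < y n).
  rewrite in_itv/= => /andP[rq /hq]; rewrite lee_fin => qr.
  by have := lt_le_trans rq qr; rewrite ltxx.
(* Here the supremum is -oo, which any rational below [y n] refutes. *)
have [q] : exists q : rat, ratr q \in `]y n - 1, y n[.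
  by apply: rat_in_itvoo; rewrite ltrBlDr ltrDl.
by rewrite in_itv/= => /andP[_ /hq].
Qed.

(** * Borel partitions as fibres of maps *)

Lemma in_sp_borel_range (R : realType) (U : Type) (m : R -> U) :
  (forall x, measurable (m @^-1` [set m x])) -> ~ countable (range m) ->
  in_sp_borel R (range m).
Proof.
move=> mm nc; pose fib u := m @^-1` [set u].
have fibE : (fib @` range m #= range m)%card.
  apply: inj_card_eq => u v /[!inE] -[x _ <-] [y _ <-] e.
  have : fib (m x) x by [].
  by rewrite e.
exists (fib @` range m); split.
- split.
  + apply/seteqP; split => // x _; exists (fib (m x)) => //.
    by exists (m x) => //; exists x.
  + by move=> _ _ [u _ <-] [v _ <-] [x [/= <- <-]].
  + by move=> _ [_ [x _ <-] <-]; exists x.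
- by move=> _ [_ [x _ <-] <-]; apply/borel_setE; exact: mm.
- by rewrite (eq_countable fibE).
- exact: card_esym.
Qed.

Lemma in_sp_borelP (R : realType) (U : Type) (C : set U) : in_sp_borel R C ->
  ~ countable C /\ exists i : R -> U,
    range i = C /\ forall u, measurable (i @^-1` [set u]).
Proof.
move=> [P [[Pcov Ptriv Pn0] PB nc CP]].
split; first by rewrite (eq_countable CP).
have /card_set_bijP[f [fCP finj fsurj]] := CP.
have /choice[i iP] : forall x, exists u, C u /\ f u x.
  move=> x; have : cover P id x by rewrite Pcov.
  by move=> [B PB' Bx]; have [u Cu fu] := fsurj _ PB'; exists u; rewrite fu.
have iE u x : C u -> f u x -> i x = u.
  move=> Cu fux; have [Ci fix_] := iP x.
  apply: finj; rewrite ?inE//.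
  by apply: Ptriv; [exact: fCP|exact: fCP|exists x].
exists i; split.
  apply/seteqP; split => [_ [x _ <-]|u Cu]; first exact: (iP x).1.
  have [x fux] := Pn0 _ (fCP _ Cu).
  by exists x => //; exact: iE.
move=> u; have [Cu|nCu] := pselect (C u).
  have -> : i @^-1` [set u] = f u.
    apply/seteqP; split => [x /= <-|x fux]; first exact: (iP x).2.
    exact: iE.
  by have /borel_setE := PB _ (fCP _ Cu).
suff -> : i @^-1` [set u] = set0 by [].
by apply/seteqP; split => // x /= iu; apply: nCu; rewrite -iu; exact: (iP x).1.
Qed.

(** * Cofinal families of countable sets *)

(** Enlarge each member of a cofinal family of least size to a member of [F]. The last clause serves
    the range of [m], which may be a proper part of [F0]. *)
Lemma is_cf_sub_cofinal (T : Type) (A : set T) F : cofinal_family A F ->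
  exists F0, [/\ F0 `<=` F, cofinal_family A F0 &
    forall G, G `<=` F0 -> cofinal_family A G -> is_cf A G].
Proof.
move=> cF; have [G cG Gmin] := @exists_least_card _ (cofinal_family A)
  (ex_intro _ F cF).
have /choice[f fP] : forall X, exists Y, G X -> F Y /\ X `<=` Y.
  move=> X; have [GX|] := pselect (G X); last by exists X.
  by have [Y FY XY] := cF.2 _ (cG.1 _ GX); exists Y.
exists (f @` G); split.
- by move=> _ [X GX <-]; exact: (fP _ GX).1.
- split; first by move=> _ [X GX <-]; apply: cF.1; exact: (fP _ GX).1.
  move=> X /cG.2[Y GY XY]; exists (f Y); first by exists Y.
  exact: (subset_trans XY (fP _ GY).2).
- move=> H HF cH; split; first by exists H.
  move=> K cK; apply: card_le_trans (Gmin _ cK).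
  exact: card_le_trans (subset_card_le HF) (card_image_le _ _).
Qed.

Lemma cofinal_countable_sub (T : Type) (A : set T) F X :
  infinite_set A -> cofinal_family A F -> countable X -> X `<=` A ->
  exists2 Y, F Y & X `<=` Y.
Proof.
move=> /infiniteP/card_subP[B BN BA] cF cX XA.
(* [X] may be finite, so it is padded with a countably infinite [B]. *)
have [|Y FY XY] := cF.2 (X `|` B).
  split; first by rewrite subUset.
  apply: eq_card_nat.
    rewrite -bigcup2E; apply: bigcup_countable => // -[//|[|[]]//] _.
    by rewrite /= (eq_countable BN).
  apply: sub_infinite_set (@subsetUr _ X B) _.
  by apply/infiniteP; have /card_eqPle[] := BN.
by exists Y => // x Xx; apply: XY; left.
Qed.

(** A countable [F] would cover [A] by countably many countable sets. *)
Lemma cofinal_uncountable (T : Type) (A : set T) F :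
  ~ countable A -> cofinal_family A F -> ~ countable F.
Proof.
move=> ncA cF cF'.
have iA : infinite_set A by move=> /finite_set_countable.
apply: ncA.
have : countable (\bigcup_(Y in F) Y).
  apply: bigcup_countable => // Y /cF.1[_ YN].
  by rewrite (eq_countable YN).
apply: sub_countable; apply: subset_card_le => x Ax.
have xA : [set x] `<=` A by move=> _ ->.
have [Y FY xY] := cofinal_countable_sub iA cF (countable1 x) xA.
by exists Y => //; exact: xY.
Qed.

Theorem theorem3p2 (R : realType) (T : Type) (kappa : set T) :
  (exists F : set (set T), cofinal_kurepa_family kappa F) ->
  in_sp_borel R kappa ->
  exists2 C : set (set T), is_cf kappa C & in_sp_borel R C.
Proof.
move=> [F [cF [_ kF]]] /in_sp_borelP[ncA [i [iA mi]]].
have infA : infinite_set kappa by move=> /finite_set_countable.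
have [F0 [F0F cF0 F0min]] := is_cf_sub_cofinal cF.
have [p [mp psurj]] := exists_measurable_surj_seq R.
pose S x := range (fun n => i (p n x)).
have SA x : S x `<=` kappa by move=> _ [n _ <-]; rewrite -iA; exists (p n x).
have Sctbl x : countable (S x) by exact: card_image_le.
have mS Z : countable Z -> measurable [set x | S x `<=` Z].
  move=> cZ.
  (* S x lies in Z iff each p_n x lies in one of the countably many pieces indexed by Z. *)
  have -> : [set x | S x `<=` Z] =
      \bigcap_n (setT `&` p n @^-1` (\bigcup_(u in Z) i @^-1` [set u])).
    apply/seteqP; split => [x SZ n _|x xP _ [n _ <-]].
      by split => //; exists (i (p n x)) => //; apply: SZ; exists n.
    by have [_ [u Zu /= ->]] := xP n Logic.I.
  apply: bigcapT_measurable => n; apply: mp => //.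
  exact: measurable_countable_bigcup.
have [w wo] := well_ordering_principle (set T).
pose least x Y := [/\ F0 Y, S x `<=` Y & forall Z, F0 Z -> S x `<=` Z -> w Y Z].
have /choice[m mP] : forall x, exists Y,
    least x Y /\ forall Z, least x Z -> Y = Z.
  move=> x; pose above := [pred Y : set T | `[< F0 Y /\ S x `<=` Y >]].
  have leastE Y : minimum_of w above Y <-> least x Y.
    split=> [[/asboolP[FY SY] Ymin]|[FY SY Ymin]].
      by split => // Z FZ SZ; apply: Ymin; apply/asboolP.
    by split; [exact/asboolP|move=> Z /asboolP[]; exact: Ymin].
  have [|Y [/leastE Yl Yu]] := wo above.
    have [Y FY SY] := cofinal_countable_sub infA cF0 (Sctbl x) (@SA x).
    by exists Y; apply/asboolP.
  by exists Y; split => // Z /leastE/Yu.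
have crange : cofinal_family kappa (range m).
  split; first by move=> _ [x _ <-]; have [[/cF0.1]] := mP x.
  move=> X [XA /card_eqPle[/countable_injP[f finj] _]].
  (* [f] numbers [X] injectively; [y n] is a real in the piece of the element numbered n, or 0 if
     there is none. *)
  have /choice[y yP] : forall n, exists y, forall u, X u -> f u = n -> i y = u.
    move=> n; have [[u [Xu fu]]|nou] := pselect (exists u, X u /\ f u = n).
      have [y _ iy] : range i u by rewrite iA; exact: XA.
      by exists y => v Xv fv; rewrite iy; apply: finj; rewrite ?inE// fu fv.
    by exists 0 => u Xu fu; case: nou; exists u.
  have [x px] := psurj y; exists (m x); first by exists x.
  have [[_ Sm _] _] := mP x; apply: subset_trans Sm => u Xu.
  by exists (f u) => //; rewrite px; exact: yP.
exists (range m).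
  by apply: F0min => //; move=> _ [x _ <-]; have [[]] := mP x.
apply: in_sp_borel_range; last exact: cofinal_uncountable crange.
move=> x0; set Y := m x0; have [[FY _ _] _] := mP x0; rewrite -/Y in FY.
pose K := [set Y `&` Z | Z in [set Z | F0 Z /\ ~~ w Y Z]].
have cY : countable Y.
  by have [_ YN] := cF0.1 _ FY; rewrite (eq_countable YN).
(* Once S x lies in Y, lying in Z amounts to lying in the trace of Z on Y, so only the traces in [K]
   have to be removed. *)
have -> : m @^-1` [set Y] =
    [set x | S x `<=` Y] `\` \bigcup_(Z in K) [set x | S x `<=` Z].
  apply/seteqP; split => [x /= mxY|x [/= SY notK]].
    have [[_ SY Ymin] _] := mP x; rewrite mxY in SY Ymin; split => //.
    move=> [_ [Z [FZ /negP nw] <-] SZ]; apply: nw; apply: Ymin => //.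
    by move=> u /SZ[].
  apply: (mP x).2; split => // Z FZ SZ; apply: contrapT => /negP nw.
  apply: notK; exists (Y `&` Z); first by exists Z.
  by rewrite /= subsetI.
apply: measurableD; first exact: mS.
apply: measurable_countable_bigcup.
  apply: sub_countable (kF _ cY); apply: subset_card_le.
  by move=> _ [Z [FZ _] <-]; exists Z => //; exact: F0F.
move=> _ [Z _ <-]; apply: mS.
exact: sub_countable (subset_card_le (@subIsetl _ Y Z)) cY.
Qed.
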